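(* Let $J$ be a Jordan algebra over a field $\mathbb{F}$ and let $V$ be an $s$-dimensional vector space over $\mathbb{F}$ with basis $e_1,\dots,e_s$. There exists a one-to-one correspondence between the set of $Aut(J)$-orbits on $T_{s}(J)$ and the set of isomorphism classes of $E(J,V)$.
   Context: A Jordan algebra over $\mathbb{F}$ is a commutative $\mathbb{F}$-algebra $(J,\circ)$ with $x^{2}\circ(x\circ y)=x\circ(x^{2}\circ y)$ for all $x,y$. $Ann(J)=\{x\in J: x\circ J=0\}$. $Z^{2}(J,V)$ is the space of symmetric bilinear maps $\theta:J\times J\to V$ with $\theta(x^{2},x\circ y)=\theta(x,x^{2}\circ y)$ for all $x,y\in J$; $B^{2}(J,V)=\{\delta f: f\in Hom(J,V)\}$ (linear maps) with $\delta f(x,y)=f(x\circ y)$; $H^{2}(J,V)=Z^{2}(J,V)/B^{2}(J,V)$, with $[\theta]$ the class of $\theta$. The radical of $\theta$ is $\theta^{\perp}=\{x\in J:\theta(x,y)=0\ \forall y\in J\}$. For $\theta\in Z^2(J,V)$, $J_{\theta}=J\oplus V$ with product $(x+v)\circ_{J_\theta}(y+w)=x\circ y+\theta(x,y)$ (this is a Jordan algebra). $Aut(J)$ acts on $Z^{2}(J,\mathbb{F})$ by $(\phi\theta)(x,y)=\theta(\phi(x),\phi(y))$, which induces an action on $H^2(J,\mathbb{F})$ and on the Grassmannian $G_s(H^{2}(J,\mathbb{F}))$ of $s$-dimensional subspaces by $\phi\langle[\theta_1],\dots,[\theta_s]\rangle=\langle[\phi\theta_1],\dots,[\phi\theta_s]\rangle$.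 $T_s(J)$ is the ($Aut(J)$-stable) set of all $W=\langle[\theta_1],\dots,[\theta_s]\rangle\in G_s(H^{2}(J,\mathbb{F}))$ with $\bigcap_{i=1}^{s}\theta_i^{\perp}\cap Ann(J)=0$ (this condition does not depend on the choices of basis and representatives). A Jordan algebra $K$ has an annihilator component if $K=I\oplus\mathbb{F}x$ is a direct sum of two ideals with $0\neq x\in Ann(K)$. $E(J,V)$ is the set of all Jordan algebras $J_\theta$, $\theta\in Z^2(J,V)$, which have no annihilator components and whose annihilator is $s$-dimensional; equivalently, $E(J,V)=\{J_\theta:\theta(x,y)=\sum_{i=1}^{s}\theta_i(x,y)e_i,\ \langle[\theta_1],\dots,[\theta_s]\rangle\in T_s(J)\}$. Isomorphism classes are taken with respect to algebra isomorphism. The correspondence meant is the one sending the orbit of $\langle[\theta_1],\dots,[\theta_s]\rangle$ to the isomorphism class of $J_\theta$, $\theta=\sum_i\theta_i e_i$. *)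

(* Defs.v *)
From HB Require Import structures.
From mathcomp Require Import all_boot all_order all_algebra.
From mathcomp Require Import generic_quotient ring_quotient sesquilinear.
From mathcomp Require Import all_classical.

Set Implicit Arguments.
Unset Strict Implicit.
Unset Printing Implicit Defensive.

Import GRing.Theory.

Local Open Scope ring_scope.
Local Open Scope quotient_scope.
Local Open Scope classical_set_scope.

(* Neither finite dimension nor any condition on the characteristic of F is
   assumed. *)
HB.mixin Record isJordan (F : fieldType) J of GRing.Lmodule F J := {
  jmul : J -> J -> J;
  jmul_bilinear : bilinear_for *:%R *:%R jmul;
  jmulC : commutative jmul;
  jordan_identity : forall x y,
    jmul (jmul x x) (jmul x y) = jmul x (jmul (jmul x x) y)
}.

#[short(type="jordanType")]
HB.structure Definition Jordan (F : fieldType) :=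
  {J of GRing.Lmodule F J & isJordan F J}.

Notation "x \jo y" := (jmul x y) (at level 40, left associativity) : ring_scope.

Section LinearAlgebra.
Variables (F : fieldType) (M : lmodType F) (s : nat).
Implicit Types v : 'I_s -> M.

Definition lspan v : set M :=
  [set x | exists c : 'I_s -> F, x = \sum_(i < s) c i *: v i].

Definition lfree v : Prop :=
  forall c : 'I_s -> F, \sum_(i < s) c i *: v i = 0 -> forall i, c i = 0.

Definition has_dim (W : set M) : Prop := exists v, lfree v /\ W = lspan v.

End LinearAlgebra.

Definition Grassmannian (F : fieldType) (s : nat) (M : lmodType F)
  : set (set M) := [set W | has_dim s W].

Section JordanTheory.
Variable F : fieldType.
Implicit Types J K L : jordanType F.

Definition annihilator J : set J := [set x | forall y, x \jo y = 0].

Record jordan_iso K L := JordanIso {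
  iso_fun :> {linear K -> L};
  iso_bij : bijective iso_fun;
  isoM : {morph iso_fun : x y / x \jo y}
}.

Definition isomorphic K L : Prop := inhabited (jordan_iso K L).

Definition Aut J := jordan_iso J J.

(* One-sided absorption suffices, the product being commutative. *)
Definition is_ideal K (I : set K) : Prop :=
  [/\ I 0,
      forall (a : F) x y, I x -> I y -> I (a *: x + y) &
      forall x y, I x -> I (x \jo y)].

Definition line K (x : K) : set K := [set y | exists a : F, y = a *: x].

Definition has_annihilator_component K : Prop :=
  exists (I : set K) (x : K),
    [/\ is_ideal I, is_ideal (line x), x != 0 & annihilator x] /\
    (I `&` line x = [set 0] /\
     forall z, exists y l, [/\ I y, line x l & z = y + l]).

End JordanTheory.

Section Cocycles.
Variables (F : fieldType) (J : jordanType F) (V : lmodType F).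
Implicit Types theta : J -> J -> V.

Definition cocycle theta : Prop :=
  [/\ bilinear_for *:%R *:%R theta,
      forall x y, theta x y = theta y x &
      forall x y, theta (x \jo x) (x \jo y) = theta x ((x \jo x) \jo y)].

Definition cocycle_pred : pred (J -> J -> V) := fun theta => `[< cocycle theta >].

Fact cocycle_submod_closed : subsemimod_closed cocycle_pred.
Proof.
split; first split.
- rewrite unfold_in; apply/asboolP; split=> //.
  by split=> u a x y; rewrite /= scaler0 addr0.
- move=> f g; rewrite !unfold_in => /asboolP[[fl fr] fC fJ] /asboolP[[gl gr] gC gJ].
  have fgE x y : (f + g) x y = f x y + g x y by [].
  apply/asboolP; split=> [|x y|x y]; rewrite ?fgE ?fJ ?gJ 1?fC 1?gC //.
  split=> u a x y.
    rewrite !fgE; have := congr2 +%R (fl u a x y) (gl u a x y).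
    by move=> /= ->; rewrite scalerDr addrACA.
  rewrite !fgE; have := congr2 +%R (fr u a x y) (gr u a x y).
  by move=> /= ->; rewrite scalerDr addrACA.
- move=> b f; rewrite !unfold_in => /asboolP[[fl fr] fC fJ].
  have bfE x y : (b *: f) x y = b *: f x y by [].
  apply/asboolP; split=> [|x y|x y]; rewrite ?bfE ?fJ 1?fC //.
  split=> u a x y.
    rewrite !bfE; have := congr1 ( *:%R b) (fl u a x y).
    by move=> /= ->; rewrite scalerDr !scalerA mulrC.
  rewrite !bfE; have := congr1 ( *:%R b) (fr u a x y).
  by move=> /= ->; rewrite scalerDr !scalerA mulrC.
Qed.

HB.instance Definition _ :=
  GRing.isSubmodClosed.Build F (J -> J -> V) cocycle_pred cocycle_submod_closed.

Record Z2 := MkZ2 { Z2_val :> J -> J -> V; _ : cocycle_pred Z2_val }.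

HB.instance Definition _ := [isSub for Z2_val].
HB.instance Definition _ := [Choice of Z2 by <:].
HB.instance Definition _ := [SubChoice_isSubLmodule of Z2 by <:].

Lemma Z2P (theta : Z2) : cocycle theta.
Proof. exact/asboolP/(valP theta). Qed.

Definition mkZ2 theta (H : cocycle theta) : Z2 := MkZ2 (asboolT H).

Definition radical (theta : Z2) : set J := [set x | forall y, theta x y = 0].

Definition coboundary (theta : Z2) : Prop :=
  exists f : {linear J -> V}, forall x y, theta x y = f (x \jo y).

Definition B2 : pred Z2 := fun theta : Z2 => `[< coboundary theta >].

Fact B2_submod_closed : subsemimod_closed B2.
Proof.
split; first split.
- rewrite unfold_in; apply/asboolP.
  by exists (\0 : {linear J -> V}).
- move=> t u; rewrite !unfold_in => /asboolP[f tf] /asboolP[g ug].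
  apply/asboolP; exists (f \+ g : {linear J -> V}) => x y /=.
  by rewrite -tf -ug.
- move=> a t; rewrite !unfold_in => /asboolP[f tf].
  apply/asboolP; exists (a \*: f : {linear J -> V}) => x y /=.
  by rewrite -tf.
Qed.

HB.instance Definition _ :=
  GRing.isSubmodClosed.Build F Z2 B2 B2_submod_closed.

Definition H2 : Type :=
  Quotient.quot (GRing.ZmodClosed.clone Z2 B2 _).

HB.instance Definition _ := EqQuotient.on H2.
HB.instance Definition _ := GRing.Zmodule.on H2.

Definition H2_class (theta : Z2) : H2 := \pi_(H2) theta.

Lemma H2_classP (theta eta : Z2) :
  H2_class theta = H2_class eta <-> coboundary (theta - eta).
Proof.
split=> [|h]; first by move/eqP; rewrite -Quotient.idealrBE => /asboolP.
by apply/eqP; rewrite -Quotient.idealrBE; apply/asboolP.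
Qed.

Lemma H2_reprK (h : H2) : H2_class (repr h) = h.
Proof. exact: reprK. Qed.

Lemma H2_classD (theta eta : Z2) :
  H2_class (theta + eta) = H2_class theta + H2_class eta.
Proof. exact: raddfD. Qed.

Definition H2_scale (a : F) (h : H2) : H2 :=
  H2_class (a *: repr h).

Lemma H2_scaleE (a : F) (theta : Z2) :
  H2_scale a (H2_class theta) = H2_class (a *: theta).
Proof.
have /H2_classP[f fP] := H2_reprK (H2_class theta).
apply/H2_classP; exists (a \*: f : {linear J -> V}) => x y.
by rewrite -scalerBr -[RHS]/(a *: f (x \jo y)) -fP.
Qed.

Fact H2_scaleA a b h : H2_scale a (H2_scale b h) = H2_scale (a * b) h.
Proof. by rewrite -[h]H2_reprK !H2_scaleE scalerA. Qed.

Fact H2_scale1 : left_id 1 H2_scale.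
Proof. by move=> h; rewrite -[h]H2_reprK !H2_scaleE scale1r. Qed.

Fact H2_scaleDr : right_distributive H2_scale +%R.
Proof.
move=> a h k; rewrite -[h]H2_reprK -[k]H2_reprK.
by rewrite -H2_classD !H2_scaleE scalerDr H2_classD.
Qed.

Fact H2_scaleDl h : {morph H2_scale^~ h : a b / a + b}.
Proof.
by move=> a b; rewrite -[h]H2_reprK !H2_scaleE scalerDl H2_classD.
Qed.

HB.instance Definition _ := GRing.Zmodule_isLmodule.Build F H2
  H2_scaleA H2_scale1 H2_scaleDr H2_scaleDl.

Fact act_subproof (phi : Aut J) (theta : Z2) :
  cocycle (fun x y => theta (phi x) (phi y)).
Proof.
have [[tl tr] tC tJ] := Z2P theta.
split=> [|x y|x y]; last 2 first.
- exact: tC.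
- by rewrite !isoM tJ.
split=> u a x y; rewrite linearP ?tr //.
by rewrite [LHS](tl (phi u)).
Qed.

Definition act (phi : Aut J) (theta : Z2) : Z2 := mkZ2 (act_subproof phi theta).

Definition actH (phi : Aut J) (h : H2) : H2 :=
  H2_class (act phi (repr h)).

Lemma actHE (phi : Aut J) (theta : Z2) :
  actH phi (H2_class theta) = H2_class (act phi theta).
Proof.
have /H2_classP[f fP] := H2_reprK (H2_class theta).
apply/H2_classP; exists (f \o phi : {linear J -> V}) => x y.
by have := fP (phi x) (phi y); rewrite -isoM.
Qed.

(* The image of <h_1, ..., h_s> is <phi h_1, ..., phi h_s>. *)
Definition actG (phi : Aut J) (W : set H2) : set H2 := actH phi @` W.

Definition Aut_orbit (W : set H2) : set (set H2) := [set actG phi W | phi in setT].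

End Cocycles.

Section Extension.
Variables (F : fieldType) (J : jordanType F) (V : lmodType F).

Definition extension (theta : Z2 J V) : Type := (J * V)%type.

Section Product.
Variable theta : Z2 J V.

HB.instance Definition _ :=
  GRing.Lmodule.copy (extension theta) (J * V)%type.

Definition ext_mul (p q : extension theta) : extension theta :=
  (p.1 \jo q.1, theta p.1 q.1).

Fact ext_mul_bilinear : bilinear_for *:%R *:%R ext_mul.
Proof.
have [[tl tr] tC tJ] := Z2P theta.
have [jl jr] := @jmul_bilinear F J.
split=> [[u u'] a [x x'] [y y']|[u u'] a [x x'] [y y']]; rewrite /ext_mul /=.
- by congr pair; [exact: (jl u)|exact: (tl u)].
- by congr pair; [exact: (jr u)|exact: (tr u)].
Qed.

Fact ext_mulC : commutative ext_mul.
Proof.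
have [_ tC _] := Z2P theta.
by move=> p q; rewrite /ext_mul jmulC tC.
Qed.

Fact ext_jordan x y : ext_mul (ext_mul x x) (ext_mul x y) =
  ext_mul x (ext_mul (ext_mul x x) y).
Proof.
have [_ _ tJ] := Z2P theta.
by rewrite /ext_mul /= jordan_identity tJ.
Qed.

HB.instance Definition _ := isJordan.Build F (extension theta)
  ext_mul_bilinear ext_mulC ext_jordan.

End Product.
End Extension.

Section Classification.
Variables (F : fieldType) (J : jordanType F).

(* The radical condition does not depend on the choice of the theta_i. *)
Definition T (s : nat) : set (set (H2 J F^o)) :=
  [set W | Grassmannian s W /\
     exists theta : 'I_s -> Z2 J F^o,
       W = lspan (fun i => H2_class (theta i)) /\
       (\bigcap_i radical (theta i)) `&` @annihilator F J = [set 0]].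

Definition T_orbits (s : nat) : set (set (set (H2 J F^o))) :=
  [set Aut_orbit W | W in T s].

(* Classes of algebras are bare predicates: [set (jordanType F)] would be a
   universe inconsistency. *)
Definition E (s : nat) (V : lmodType F) : jordanType F -> Prop :=
  fun K => (exists theta : Z2 J V, K = extension theta) /\
    ~ has_annihilator_component K /\ has_dim s (@annihilator F K).

Definition iso_class (A : jordanType F -> Prop) (K : jordanType F) :
  jordanType F -> Prop := fun L => A L /\ isomorphic K L.

Definition iso_classes (A : jordanType F -> Prop) :
  (jordanType F -> Prop) -> Prop :=
  fun C => exists2 K, A K & C = iso_class A K.

Fact combine_subproof (s : nat) (V : lmodType F) (e : 'I_s -> V)
    (theta : 'I_s -> Z2 J F^o) :
  cocycle (fun x y => \sum_(i < s) (theta i x y : F) *: e i).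
Proof.
split=> [|x y|x y]; last 2 first.
- by apply: eq_bigr => i _; have [_ -> _] := Z2P (theta i).
- by apply: eq_bigr => i _; have [_ _ ->] := Z2P (theta i).
split=> u a x y; rewrite /= scaler_sumr -big_split /=; apply: eq_bigr => i _;
  have [[tl tr] _ _] := Z2P (theta i); rewrite scalerA -scalerDl.
- by congr (_ *: _); exact: (tl u).
- by congr (_ *: _); exact: (tr u).
Qed.

Definition combine (s : nat) (V : lmodType F) (e : 'I_s -> V)
    (theta : 'I_s -> Z2 J F^o) : Z2 J V := mkZ2 (combine_subproof e theta).

End Classification.

Arguments T {F} J s.
Arguments T_orbits {F} J s.
Arguments E {F} J s V.

(* Main.v *)
(* A cocycle theta : J x J -> V is a tuple of scalar cocycles theta_i, and
   Ann(J_theta) = (Ann(J) n rad theta) + V, so that Ann(J_theta) has dimension s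
   iff Ann(J) n rad theta = 0, in which case Ann(J_theta) = V. Then J_theta has
   an annihilator component iff some nonzero functional on V sends theta to a
   coboundary, that is, iff the [theta_i] are linearly dependent. Finally, an
   isomorphism J_theta -> J_eta preserves the annihilator V, so it has the form
   (x, v) |-> (phi x, psi v + g x) with eta(phi x, phi y) = psi(theta(x, y)) +
   g(x y); modulo coboundaries this says that phi moves the span of the [eta_i]
   to that of the [theta_i]. *)
Require Import Defs.
From HB Require Import structures.
From mathcomp Require Import all_boot all_order all_algebra.
From mathcomp Require Import all_classical.

Set Implicit Arguments.
Unset Strict Implicit.
Unset Printing Implicit Defensive.

Import GRing.Theory.

Local Open Scope ring_scope.
Local Open Scope classical_set_scope.

(** * Spans and freeness of families of fixed length [s], through square matrices *)

Section FiniteFamilies.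
Variables (F : fieldType) (M : lmodType F) (s : nat).
Implicit Types (v w : 'I_s -> M) (A B : 'M[F]_s).

Lemma mem_lspan v i : lspan v (v i).
Proof.
exists (fun j => (j == i)%:R); rewrite (bigD1 i) //= eqxx scale1r.
by rewrite big1 ?addr0 // => j /negPf ->; rewrite scale0r.
Qed.

Lemma lincomb_trans v w A (c : 'I_s -> F) :
  (forall i, v i = \sum_j A i j *: w j) ->
  \sum_i c i *: v i = \sum_j (\sum_i c i * A i j) *: w j.
Proof.
move=> vE; under eq_bigr do rewrite vE scaler_sumr.
rewrite exchange_big; apply: eq_bigr => j _ /=.
by rewrite scaler_suml; apply: eq_bigr => i _; rewrite scalerA.
Qed.

Lemma sub_lspan v w : (forall i, lspan w (v i)) -> lspan v `<=` lspan w.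
Proof.
move=> /choice[A vE] _ [c ->]; exists (fun j => \sum_i c i * A i j).
rewrite (@lincomb_trans v w (\matrix_(i, j) A i j)) => [|i].
  by apply: eq_bigr => j _; congr (_ *: _); apply: eq_bigr => i _; rewrite mxE.
by rewrite vE; apply: eq_bigr => j _; rewrite mxE.
Qed.

Lemma lspan_mx v w :
  (forall i, lspan w (v i)) -> exists A, forall i, v i = \sum_j A i j *: w j.
Proof.
move=> /choice[A vE]; exists (\matrix_(i, j) A i j) => i.
by rewrite vE; apply: eq_bigr => j _; rewrite mxE.
Qed.

(** Substituting one expansion into the other writes each [w i] with coefficients from row [i] of
    [A *m B]; freeness of [w] compares them with the trivial expansion. *)
Lemma lfree_mx1 w A B v :
  lfree w -> (forall i, w i = \sum_j A i j *: v j) ->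
  (forall i, v i = \sum_j B i j *: w j) -> A *m B = 1%:M.
Proof.
move=> wfree wE vE; apply/matrixP => i j; rewrite !mxE.
apply/eqP; rewrite -subr_eq0; apply/eqP; move: j.
apply: wfree; under eq_bigr do rewrite scalerBl.
rewrite sumrB -(lincomb_trans (A i) vE) -wE.
rewrite (bigD1 i) //= eqxx scale1r big1 ?addr0 ?subrr // => j.
by rewrite eq_sym => /negPf ->; rewrite scale0r.
Qed.

(** Both families have length [s], so the transition matrices are square and a one-sided inverse is
    two-sided. *)
Lemma lfree_lspan v w : lfree w -> lspan v = lspan w -> lfree v.
Proof.
move=> wfree vw.
have [A wE] : exists A, forall i, w i = \sum_j A i j *: v j.
  by apply: lspan_mx => i; rewrite vw; apply: mem_lspan.
have [B vE] : exists B, forall i, v i = \sum_j B i j *: w j.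
  by apply: lspan_mx => i; rewrite -vw; apply: mem_lspan.
have /mulmx1C BA := lfree_mx1 wfree wE vE.
(* A relation [c] on [v] gives [c B = 0], and right multiplication by [A] recovers [c]. *)
move=> c; rewrite (lincomb_trans c vE) => /wfree cB i.
have : (\row_i c i) *m (B *m A) = 0.
  rewrite mulmxA [X in X *m A](_ : _ = 0) ?mul0mx //.
  apply/matrixP => k j; rewrite !mxE -[RHS](cB j).
  by apply: eq_bigr => l _; rewrite mxE.
by rewrite BA mulmx1 => /matrixP/(_ 0 i); rewrite !mxE.
Qed.

Lemma has_dim_lfree v : has_dim s (lspan v) -> lfree v.
Proof. by move=> [w [wfree vw]]; apply: lfree_lspan wfree vw. Qed.

(** This is the dimension count: [s] free vectors inside a span of [s] vectors fill it. *)
Lemma lfree_sub_lspan v w :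
  lfree v -> (forall i, lspan w (v i)) -> lspan w = lspan v.
Proof.
move=> vfree vw; apply/seteqP; split; last exact: sub_lspan.
have [A vE] := lspan_mx vw.
(* A row killing [A] on the left would be a linear relation on [v], so the left kernel is zero. *)
have Aunit : A \in unitmx.
  rewrite -row_free_unit -kermx_eq0; apply/eqP/row_matrixP => k.
  rewrite row0; set r := row k _.
  have rA : r *m A = 0 by apply/eqP; rewrite -sub_kermx row_sub.
  apply/rowP => i; rewrite [RHS]mxE; move: i; apply: vfree.
  rewrite (lincomb_trans _ vE) big1 // => j _.
  by move/matrixP: rA => /(_ 0 j); rewrite !mxE => ->; rewrite scale0r.
apply: sub_lspan => i; exists (invmx A i).
rewrite (lincomb_trans _ vE) (bigD1 i) //=.
have AA j : \sum_k invmx A i k * A k j = (i == j)%:R.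
  by move/matrixP: (mulVmx Aunit) => /(_ i j); rewrite !mxE.
rewrite AA eqxx scale1r big1 ?addr0 // => j.
by rewrite eq_sym AA => /negPf ->; rewrite scale0r.
Qed.

End FiniteFamilies.

Definition linear_pack (F : fieldType) (U V : lmodType F) (f : U -> V)
  (f_lin : linear f) : {linear U -> V} :=
  HB.pack f (@GRing.isLinear.Build F U V _ f f_lin).

(** * Jordan products and the groupoid of Jordan isomorphisms *)

Section JordanMaps.
Variable F : fieldType.
Implicit Types K L M : jordanType F.

Lemma jmul0l K (x : K) : 0 \jo x = 0.
Proof.
have [jl _] := @jmul_bilinear F K.
by have := jl x (-1) 0 0; rewrite /= scaler0 addr0 scaleN1r addNr.
Qed.

Lemma jmulDl K (x y z : K) : (x + y) \jo z = x \jo z + y \jo z.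
Proof.
have [jl _] := @jmul_bilinear F K.
by have := jl z 1 x y; rewrite /= !scale1r.
Qed.

Lemma jmulZl K a (x y : K) : (a *: x) \jo y = a *: (x \jo y).
Proof.
have [jl _] := @jmul_bilinear F K.
by have := jl y a x 0; rewrite /= jmul0l !addr0.
Qed.

Definition iso_id K : jordan_iso K K :=
  @JordanIso F K K idfun (inv_bij (fun=> erefl)) (fun _ _ => erefl).

Fact iso_comp_subproof K L M (f : jordan_iso K L) (g : jordan_iso L M) :
  {morph (g \o f : {linear K -> M}) : x y / x \jo y}.
Proof. by move=> x y /=; rewrite !isoM. Qed.

Definition iso_comp K L M (f : jordan_iso K L) (g : jordan_iso L M) :
  jordan_iso K M :=
  JordanIso (bij_comp (iso_bij g) (iso_bij f)) (iso_comp_subproof f g).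

Lemma iso_inv K L (f : jordan_iso K L) :
  exists g : jordan_iso L K, cancel f g /\ cancel g f.
Proof.
have [g fK gK] := iso_bij f.
have g_lin : linear g.
  by move=> a x y; apply: (can_inj fK); rewrite linearP !gK.
have gM : {morph linear_pack g_lin : x y / x \jo y}.
  by move=> x y; apply: (can_inj fK); rewrite isoM !gK.
by exists (@JordanIso F L K (linear_pack g_lin) (Bijective gK fK) gM).
Qed.

Lemma isomorphic_sym K L : isomorphic K L -> isomorphic L K.
Proof. by move=> [f]; have [g _] := iso_inv f; exists. Qed.

Lemma isomorphic_trans K L M :
  isomorphic K L -> isomorphic L M -> isomorphic K M.
Proof. by move=> [f] [g]; exists; apply: iso_comp f g. Qed.

Lemma eq_iso_class (A : jordanType F -> Prop) K L :
  isomorphic K L -> iso_class A K = iso_class A L.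
Proof.
move=> KL; apply/funext => M; apply/propext.
split=> -[AM iM]; split=> //; last exact: isomorphic_trans iM.
exact: isomorphic_trans (isomorphic_sym KL) iM.
Qed.

End JordanMaps.

(** * Linear dependence in cohomology and the action of the automorphism group *)

Section Cohomology.
Variables (F : fieldType) (J : jordanType F).
Implicit Types W : set (H2 J F^o).

Section Coefficients.
Variable V : lmodType F.
Implicit Types theta eta : Z2 J V.

Lemma Z2_sum s (theta : 'I_s -> Z2 J V) x y :
  (\sum_i theta i) x y = \sum_i theta i x y.
Proof. exact: (big_morph (fun t : Z2 J V => t x y)). Qed.

Lemma Z2_linl theta y : linear (theta^~ y).
Proof. by have [[tl _] _ _] := Z2P theta; apply: tl. Qed.

Lemma Z2_0l theta y : theta 0 y = 0.
Proof. exact: (linear0 (linear_pack (Z2_linl theta y))). Qed.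

Lemma H2_class_eq0 theta : H2_class theta = 0 <-> coboundary theta.
Proof.
have -> : 0 = H2_class 0 :> H2 J V by rewrite /H2_class raddf0.
by rewrite H2_classP subr0.
Qed.

Lemma H2_class_lincomb s (c : 'I_s -> F) (theta : 'I_s -> Z2 J V) :
  \sum_i c i *: H2_class (theta i) = H2_class (\sum_i c i *: theta i).
Proof.
rewrite (big_morph (@H2_class F J V) (@H2_classD F J V) (id1 := 0)).
  by apply: eq_bigr => i _; apply: H2_scaleE.
by rewrite /H2_class raddf0.
Qed.

End Coefficients.

(** The action is by pullback, hence reverses composition; [iso_comp phi psi] applies [phi]
    first. *)
Lemma actHM (phi psi : Aut J) (h : H2 J F^o) :
  actH phi (actH psi h) = actH (iso_comp phi psi) h.
Proof.
by rewrite -[h]H2_reprK !actHE; congr H2_class; apply: val_inj.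
Qed.

Lemma actHK (phi psi : Aut J) :
  cancel phi psi -> cancel (@actH F J F^o psi) (actH phi).
Proof.
move=> phiK h; rewrite actHM -[h in RHS]H2_reprK -[h in LHS]H2_reprK actHE.
by congr H2_class; apply: val_inj; do 2!apply/funext => ?; rewrite /= !phiK.
Qed.

Lemma actGM (phi psi : Aut J) W :
  actG phi (actG psi W) = actG (iso_comp phi psi) W.
Proof.
by rewrite /actG image_comp; apply: eq_imagel => h _; rewrite /= actHM.
Qed.

Lemma actGK (phi psi : Aut J) W :
  cancel phi psi -> actG phi (actG psi W) = W.
Proof.
move=> phiK; rewrite /actG image_comp -[RHS]image_id.
by apply: eq_imagel => h _ /=; apply: actHK.
Qed.

Lemma Aut_orbit_refl W : Aut_orbit W W.
Proof.
exists (iso_id J) => //; rewrite /actG -[RHS]image_id.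
apply: eq_imagel => h _; rewrite -[h]H2_reprK actHE.
by congr H2_class; apply: val_inj.
Qed.

Lemma Aut_orbit_actG (phi : Aut J) W : Aut_orbit (actG phi W) = Aut_orbit W.
Proof.
have [psi [phiK psiK]] := iso_inv phi.
apply/seteqP; split=> _ [rho _ <-].
  by exists (iso_comp rho phi) => //; rewrite actGM.
by exists (iso_comp rho psi) => //; rewrite -actGM (actGK _ psiK).
Qed.

Lemma actG_lspan (phi : Aut J) s (theta : 'I_s -> Z2 J F^o) :
  actG phi (lspan (fun i => H2_class (theta i))) =
  lspan (fun i => H2_class (act phi (theta i))).
Proof.
have actE c : actH phi (\sum_i c i *: H2_class (theta i)) =
              \sum_i c i *: H2_class (act phi (theta i)).
  rewrite !H2_class_lincomb actHE; congr H2_class; apply: val_inj.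
  apply/funext => x; apply/funext => y.
  rewrite /= -[LHS]/((\sum_i c i *: theta i : Z2 J F^o) (phi x) (phi y)).
  by rewrite !Z2_sum.
apply/seteqP; split=> [_ [_ [c ->] <-]|_ [c ->]].
  by exists c; rewrite actE.
by exists (\sum_i c i *: H2_class (theta i)); [exists c|rewrite actE].
Qed.


(** A relation among classes is a combination of cocycles that is a coboundary. In this form it can
    be matched with functionals on extensions. *)
Lemma lfree_H2P s (theta : 'I_s -> Z2 J F^o) :
  lfree (fun i => H2_class (theta i)) <->
  forall (c : 'I_s -> F) (f : {linear J -> F^o}),
    (forall x y, \sum_i c i * theta i x y = f (x \jo y)) -> forall i, c i = 0.
Proof.
have combE c x y : (\sum_i c i *: theta i : Z2 J F^o) x y = \sum_i c i * theta i x y.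
  by rewrite Z2_sum.
split=> free c.
  move=> f cf; apply: free; rewrite H2_class_lincomb.
  by apply/H2_class_eq0; exists f => x y; rewrite combE.
rewrite H2_class_lincomb => /H2_class_eq0[f fE].
by apply: (free c f) => x y; rewrite -fE combE.
Qed.

(* Coboundaries vanish on [Ann(J) x J], so only cohomology classes matter. *)
Lemma lspan_radical s (theta : 'I_s -> Z2 J F^o) (eta : Z2 J F^o) x :
  lspan (fun i => H2_class (theta i)) (H2_class eta) ->
  annihilator x -> (\bigcap_i radical (theta i)) x -> radical eta x.
Proof.
move=> [c]; rewrite H2_class_lincomb => /H2_classP[f fE] annx radx y.
have -> : eta x y = (\sum_i c i *: theta i : Z2 J F^o) x y.
  apply/eqP; rewrite -subr_eq0; apply/eqP.
  by rewrite -(linear0 f) -(annx y) -fE.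
rewrite Z2_sum big1 // => i _.
by rewrite -[LHS]/(c i *: theta i x y) radx ?scaler0.
Qed.

(** Membership in [T] only provides some representatives. Those and the given ones span the same
    classes, so they have the same common radical inside the annihilator. *)
Lemma T_lspanP s (theta : 'I_s -> Z2 J F^o) :
  T J s (lspan (fun i => H2_class (theta i))) <->
  lfree (fun i => H2_class (theta i)) /\
  (\bigcap_i radical (theta i)) `&` @annihilator F J = [set 0].
Proof.
split=> [[/has_dim_lfree tfree [eta [te etaI]]]|[tfree thI]]; last first.
  split; last by exists theta.
  by exists (fun i => H2_class (theta i)).
split=> //; rewrite -etaI; apply/seteqP; split=> x [radx annx]; split=> // i _.
  apply: lspan_radical annx radx; rewrite te.
  exact: (mem_lspan (fun i => H2_class (eta i))).
apply: lspan_radical annx radx; rewrite -te.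
exact: (mem_lspan (fun i => H2_class (theta i))).
Qed.

End Cohomology.

(** * Annihilators, isomorphisms and annihilator components of extensions *)

Section Extensions.
Variables (F : fieldType) (J : jordanType F) (V : lmodType F).
Implicit Types theta eta : Z2 J V.

Lemma annihilator_extension theta (p : extension theta) :
  annihilator p <-> annihilator p.1 /\ radical theta p.1.
Proof.
split=> [annp|[annp radp] q].
  by split=> y; have := annp (y, 0) => -[].
rewrite -[LHS]/(p.1 \jo q.1, theta p.1 q.1).
by rewrite annp radp.
Qed.

Lemma annihilator_extension0 theta (p : extension theta) :
  radical theta `&` @annihilator F J = [set 0] ->
  annihilator p <-> p.1 = 0.
Proof.
move=> radI; rewrite annihilator_extension.
have -> : (annihilator p.1 /\ radical theta p.1) <->
          (radical theta `&` @annihilator F J) p.1 by split=> -[].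
by rewrite radI.
Qed.

(** The isomorphism is the block triangular map with diagonal blocks [phi], [psi] and corner [g];
    the hypothesis on [eta] is its multiplicativity in the second component. *)
Lemma isomorphic_extension theta eta (phi : Aut J) (psi psi' : {linear V -> V})
    (g : {linear J -> V}) :
  cancel psi psi' -> cancel psi' psi ->
  (forall x y, eta (phi x) (phi y) = psi (theta x y) + g (x \jo y)) ->
  isomorphic (extension theta) (extension eta).
Proof.
move=> psiK psi'K etaE; have [phi' [phiK phi'K]] := iso_inv phi.
pose h (p : extension theta) : extension eta := (phi p.1, psi p.2 + g p.1).
have h_lin : linear h.
  move=> a [x v] [y w]; congr pair => /=; first exact: linearP.
  by rewrite !linearP /= scalerDr addrACA.
have h_bij : bijective (linear_pack h_lin).
  exists (fun p : extension eta =>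
    (phi' p.1, psi' (p.2 - g (phi' p.1))) : extension theta).
    by move=> [x v]; rewrite /= phiK addrK psiK.
  by move=> [x v]; rewrite /= /h /= phi'K psi'K subrK.
have hM : {morph linear_pack h_lin : p q / p \jo q}.
  by move=> p q; congr pair => /=; rewrite ?isoM ?etaE.
by exists; exists (linear_pack h_lin).
Qed.

(** Both annihilators equal [V], so an isomorphism is block triangular; [phi], [psi] and [g] are its
    blocks. *)
Lemma isomorphic_extension_inv theta eta :
  radical theta `&` @annihilator F J = [set 0] ->
  radical eta `&` @annihilator F J = [set 0] ->
  isomorphic (extension theta) (extension eta) ->
  exists (phi : Aut J) (psi psi' : {linear V -> V}) (g : {linear J -> V}),
    [/\ cancel psi psi', cancel psi' psi &
    forall x y, eta (phi x) (phi y) = psi (theta x y) + g (x \jo y)].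
Proof.
move=> radt rade [h]; have [h' [hK h'K]] := iso_inv h.
have h_ann p : annihilator p -> annihilator (h p).
  by move=> annp q; rewrite -[q]h'K -isoM annp linear0.
have h'_ann p : annihilator p -> annihilator (h' p).
  by move=> annp q; rewrite -[q]hK -isoM annp linear0.
have h0 v : (h (0, v)).1 = 0.
  by apply/(annihilator_extension0 _ rade)/h_ann/(annihilator_extension0 _ radt).
have h'0 v : (h' (0, v)).1 = 0.
  by apply/(annihilator_extension0 _ radt)/h'_ann/(annihilator_extension0 _ rade).
have hD x v : h (x, v) = h (x, 0) + h (0, v).
  by rewrite -linearD; congr (h _); congr pair; rewrite ?addr0 ?add0r.
have h'D x v : h' (x, v) = h' (x, 0) + h' (0, v).
  by rewrite -linearD; congr (h' _); congr pair; rewrite ?addr0 ?add0r.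
(* The first component ignores [v], so [h] induces a map on the quotient [J]; likewise for [h'],
   which gives the inverse. *)
have h1 x v : (h (x, v)).1 = (h (x, 0)).1.
  by rewrite hD -[LHS]/((h (x, 0)).1 + (h (0, v)).1) h0 addr0.
have h'1 x v : (h' (x, v)).1 = (h' (x, 0)).1.
  by rewrite h'D -[LHS]/((h' (x, 0)).1 + (h' (0, v)).1) h'0 addr0.
have phi_lin : linear (fun x => (h (x, 0)).1).
  move=> a x y; rewrite -[RHS]/((a *: h (x, 0) + h (y, 0)).1) -linearP.
  by congr (h _).1; congr pair; rewrite /= scaler0 addr0.
have g_lin : linear (fun x => (h (x, 0)).2).
  move=> a x y; rewrite -[RHS]/((a *: h (x, 0) + h (y, 0)).2) -linearP.
  by congr (h _).2; congr pair; rewrite /= scaler0 addr0.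
have psi_lin : linear (fun v => (h (0, v)).2).
  move=> a v w; rewrite -[RHS]/((a *: h (0, v) + h (0, w)).2) -linearP.
  by congr (h _).2; congr pair; rewrite /= scaler0 addr0.
have psi'_lin : linear (fun v => (h' (0, v)).2).
  move=> a v w; rewrite -[RHS]/((a *: h' (0, v) + h' (0, w)).2) -linearP.
  by congr (h' _).2; congr pair; rewrite /= scaler0 addr0.
have phi_bij : bijective (linear_pack phi_lin).
  exists (fun x => (h' (x, 0)).1) => x /=.
    by rewrite -(h'1 _ (h (x, 0)).2) -surjective_pairing hK.
  by rewrite -(h1 _ (h' (x, 0)).2) -surjective_pairing h'K.
have phiM : {morph linear_pack phi_lin : x y / x \jo y}.
  move=> x y /=; rewrite -(h1 _ (theta x y)).
  by rewrite -[(x \jo y, _)]/(@jmul F (extension theta) (x, 0) (y, 0)) isoM.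
exists (JordanIso phi_bij phiM), (linear_pack psi_lin), (linear_pack psi'_lin),
  (linear_pack g_lin); split=> [v|v|x y] /=.
- by rewrite -[X in (X, _)](h0 v) -surjective_pairing hK.
- by rewrite -[X in (X, _)](h'0 v) -surjective_pairing h'K.
(* The required identity is the second component of multiplicativity, as [(x, 0)] times [(y, 0)] is
   [(x \jo y, theta x y)]. *)
have : (h (@jmul F (extension theta) (x, 0) (y, 0))).2 = eta (h (x, 0)).1 (h (y, 0)).1.
  by rewrite isoM.
by move=> <-; rewrite addrC -[RHS]/((h (x \jo y, 0) + h (0, theta x y)).2) -hD.
Qed.

(** The hyperplane where [lambda] of the second component equals [f] of the first contains every
    product, hence is an ideal; [(0, v)] lies outside it and spans a complement. *)
Lemma annihilator_component_extension theta (lambda : {linear V -> F^o})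
    (f : {linear J -> F^o}) v :
  lambda v != 0 -> (forall x y, lambda (theta x y) = f (x \jo y)) ->
  has_annihilator_component (extension theta).
Proof.
move=> lv0 lf; pose I : set (extension theta) := [set p | lambda p.2 = f p.1].
pose e : extension theta := (0, v).
have ann_e : annihilator e.
  by apply/annihilator_extension; split=> y; [apply: jmul0l|apply: Z2_0l].
exists I, e; split.
  split=> //.
  - split; rewrite /I /=; first by rewrite !linear0.
      by move=> a p q pE qE; rewrite !linearP /= pE qE.
    by move=> p q _; rewrite lf.
  - split; first by exists 0; rewrite scale0r.
      move=> a _ _ [b ->] [c ->].
      by exists (a * b + c); rewrite scalerDl scalerA.
    by move=> _ q [b ->]; exists 0; rewrite jmulZl ann_e scaler0 scale0r.
  - apply: contraNneq lv0 => e0; have -> : v = 0 by have := congr1 snd e0.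
    by rewrite linear0.
split=> [|p].
  apply/seteqP; split=> [q [Iq [a ae]]|_ ->]; last first.
    by split; [rewrite /I /= !linear0|exists 0; rewrite scale0r].
  rewrite /= ae; move: Iq; rewrite ae /I /= scaler0 linear0 linearZ /= => /eqP.
  by rewrite mulf_eq0 (negPf lv0) orbF => /eqP ->; rewrite scale0r.
(* This solves [lambda p.2 - a * lambda v = f p.1], which puts [p - a *: e] in [I]. *)
pose a : F := (lambda p.2 - f p.1) / lambda v.
exists (p - a *: e), (a *: e); split; [|by exists a|by rewrite subrK].
rewrite /I /= scaler0 oppr0 addr0 linearB linearZ /= /a.
by rewrite -[_ *: _]/(_ * _) divfK // opprB addrC subrK.
Qed.

(** [mu] is the coordinate along [x] in the splitting of [K] into [I] and the line of [x]. *)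
Lemma annihilator_component_functional (K : jordanType F) :
  has_annihilator_component K ->
  exists (mu : {linear K -> F^o}) (x : K),
    [/\ annihilator x, mu x = 1 & forall y z, mu (y \jo z) = 0].
Proof.
move=> [I [x [[[I0 ID IM] _ x0 annx] [IX IK]]]].
have coordP z : exists a : F, I (z - a *: x).
  by have [y [l [Iy [a ->] ->]]] := IK z; exists a; rewrite addrK.
have [mu Imu] := choice coordP.
have mu_unique z a : I (z - a *: x) -> mu z = a.
  move=> Iz; have Id : I ((mu z - a) *: x).
    have := ID (-1) _ _ (Imu z) Iz.
    by rewrite scaleN1r opprB addrA subrK scalerBl.
  have : (I `&` line x) ((mu z - a) *: x) by split=> //; exists (mu z - a).
  rewrite IX /= => /eqP; rewrite scaler_eq0 (negPf x0) orbF subr_eq0.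
  by move/eqP.
have mu_lin : linear (mu : K -> F^o).
  move=> a y z; apply: mu_unique.
  have := ID a _ _ (Imu y) (Imu z); congr I.
  by rewrite scalerBr scalerA addrACA -opprD -scalerDl.
exists (linear_pack mu_lin), x; split=> //=.
  by apply: mu_unique; rewrite scale1r subrr.
move=> y z; apply: mu_unique; rewrite scale0r subr0.
(* Removing from [y] its component along [x] leaves the product unchanged and puts the factor in
   [I]. *)
rewrite -[y](subrK (mu y *: x)) jmulDl jmulZl annx scaler0 addr0.
exact: IM.
Qed.

End Extensions.

(** * Extensions built from tuples of scalar cocycles *)

Section Classification.
Variables (F : fieldType) (J : jordanType F) (s : nat) (V : vectType F).
Variables (e : s.-tuple V) (he : basis_of fullv e).
Implicit Types theta eta : 'I_s -> Z2 J F^o.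

Local Notation "<[ theta ]>" := (lspan (fun i => H2_class (theta i))).
Local Notation comb := (combine (tnth e)).

Lemma basis_expansion v : v = \sum_i coord e i v *: tnth e i.
Proof.
rewrite {1}(coord_basis he (memvf v)).
by apply: eq_bigr => i _; rewrite (tnth_nth 0).
Qed.

Lemma coord_lincomb (c : 'I_s -> F) j : coord e j (\sum_i c i *: tnth e i) = c j.
Proof.
under eq_bigr do rewrite (tnth_nth 0).
exact: coord_sum_free (basis_free he).
Qed.

Lemma lfree_basis : lfree (tnth e).
Proof. by move=> c ce i; rewrite -(coord_lincomb c) ce linear0. Qed.

Lemma coord_combine theta i x y : coord e i (comb theta x y) = theta i x y.
Proof. exact: coord_lincomb. Qed.

(** The scalar cocycles are the coordinates of [theta] in the basis [e]. *)
Lemma combine_surj (theta : Z2 J V) : exists eta, theta = comb eta.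
Proof.
have [[tl tr] tC tJ] := Z2P theta.
have cocycle_coord i : cocycle (fun x y => coord e i (theta x y) : F^o).
  split=> [|x y|x y]; [|by rewrite tC|by rewrite tJ].
  split=> u a x y; rewrite -[RHS](linearP (coord e i)); congr (coord e i _).
    exact: tl.
  exact: tr.
exists (fun i => mkZ2 (cocycle_coord i)); apply: val_inj.
by apply/funext => x; apply/funext => y; apply: basis_expansion.
Qed.

Lemma radical_combine theta : radical (comb theta) = \bigcap_i radical (theta i).
Proof.
apply/seteqP; split=> [x radx i _ y|x radx y].
  by rewrite -coord_combine radx linear0.
by rewrite /= big1 // => i _; rewrite radx ?scale0r.
Qed.

Lemma E_combineP theta :
  E J s V (extension (comb theta)) <-> T J s <[theta]>.
Proof.
rewrite T_lspanP -radical_combine.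
pose ve i : extension (comb theta) := (0, tnth e i).
have ve_comb (c : 'I_s -> F) : \sum_i c i *: ve i = (0, \sum_i c i *: tnth e i).
  rewrite (big_morph (fun v => (0, v) : extension (comb theta))
    (id1 := 0) (op1 := +%R)) //=.
    by apply: eq_bigr => i _; congr pair; rewrite /= scaler0.
  by move=> v w; congr pair; rewrite /= addr0.
have ve_free : lfree ve.
  by move=> c; rewrite ve_comb => -[]; apply: lfree_basis.
split=> [[_ [noncomp [w [wfree annE]]]]|[tfree radI]].
  (* The annihilator has dimension [s] and contains the [s] free vectors [ve], so it is the copy of
     [V]. *)
  have {w wfree}annE : annihilator (J := extension (comb theta)) = lspan ve.
    rewrite annE; apply: lfree_sub_lspan ve_free _ => i; rewrite -annE.
    by apply/annihilator_extension; split=> y; [apply: jmul0l|apply: Z2_0l].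
  have radI : radical (comb theta) `&` @annihilator F J = [set 0].
    apply/seteqP; split=> [x [radx annx]|_ ->]; last first.
      by split=> y; [apply: Z2_0l|apply: jmul0l].
    have : annihilator ((x, 0) : extension (comb theta)).
      exact/annihilator_extension.
    by rewrite annE => -[c]; rewrite ve_comb => -[].
  split=> //; apply/lfree_H2P => c f cf i.
  (* [lambda] takes the value [c i] at the basis vector of index [i], and turns [comb theta] into
     the coboundary of [f]; a nonzero [c i] would split off an annihilator component. *)
  pose lambda v : F^o := \sum_i c i * coord e i v.
  have lambda_lin : linear lambda.
    move=> a v w; rewrite /lambda scaler_sumr -big_split; apply: eq_bigr => j _.
    by rewrite /= linearP mulrDr; congr (_ + _); rewrite /= mulrCA.
  apply/eqP/negP => ci0; apply: noncomp.
  apply: (@annihilator_component_extension F J V _ (linear_pack lambda_lin) f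
    (tnth e i)) => [|x y] /=; last first.
    by rewrite -cf; apply: eq_bigr => j _; rewrite coord_combine.
  rewrite /lambda (bigD1 i) //= (tnth_nth 0) coord_free ?(basis_free he) // eqxx.
  rewrite mulr1 big1 ?addr0; first exact/negP.
  move=> j ji; rewrite coord_free ?(basis_free he) //.
  by rewrite eq_sym (negPf ji) mulr0.
split; first by exists (comb theta).
split; last first.
  exists ve; split=> //; apply/seteqP.
  split=> [[x v] /(annihilator_extension0 _ radI) /= ->|_ [c ->]].
    by exists (fun i => coord e i v); rewrite ve_comb -basis_expansion.
  by apply/(annihilator_extension0 _ radI); rewrite ve_comb.
move=> /annihilator_component_functional[mu [[x v] [annx mux mu0]]].
move/(annihilator_extension0 _ radI): annx => /= x0.
have inj_lin : linear (fun y : J => (y, 0) : extension (comb theta)).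
  by move=> a y z; congr pair; rewrite /= scaler0 addr0.
(* Since [mu] kills products, the combination of the [theta i] with coefficients [mu (ve i)] is the
   coboundary of minus [mu] restricted to [J]. Independence kills the coefficients, so [mu] vanishes
   on [V], against [mux]. *)
have mue : forall i, mu (ve i) = 0.
  move/lfree_H2P: tfree => tind.
  apply: (tind _ (\- (mu \o linear_pack inj_lin))) => y z /=.
  apply/eqP; rewrite -addr_eq0; apply/eqP.
  rewrite -[RHS](mu0 (y, 0) (z, 0)).
  have -> : @jmul F (extension (comb theta)) (y, 0) (z, 0) =
      \sum_i (theta i y z : F) *: ve i + ((y \jo z, 0) : extension (comb theta)).
    by rewrite ve_comb; congr pair; rewrite /= ?add0r ?addr0.
  rewrite linearD linear_sum; congr (_ + _); apply: eq_bigr => i _.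
  by rewrite linearZ mulrC.
have : mu (x, v) = 0.
  rewrite x0 (basis_expansion v) -ve_comb linear_sum big1 // => i _.
  by rewrite linearZ /= mue scaler0.
by rewrite mux => /eqP; rewrite oner_eq0.
Qed.

(** [A] acts on the column of coordinates of [v]. *)
Definition mx_endo (A : 'M[F]_s) (v : V) : V :=
  \sum_i (\sum_j A i j * coord e j v) *: tnth e i.

Lemma mx_endo_linear A : linear (mx_endo A).
Proof.
move=> a v w; rewrite /mx_endo scaler_sumr -big_split; apply: eq_bigr => i _.
rewrite /= scalerA -scalerDl mulr_sumr -big_split; congr (_ *: _).
by apply: eq_bigr => j _; rewrite /= linearP mulrDr; congr (_ + _); rewrite /= mulrCA.
Qed.

Lemma mx_endoK (A B : 'M[F]_s) : B *m A = 1%:M -> cancel (mx_endo A) (mx_endo B).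
Proof.
move=> BA v; rewrite [RHS]basis_expansion; apply: eq_bigr => i _; congr (_ *: _).
under eq_bigr do rewrite coord_lincomb mulr_sumr.
rewrite exchange_big /= (bigD1 i) //= [X in _ + X]big1 => [|j ji].
  under eq_bigr do rewrite mulrA.
  by rewrite -mulr_suml; move/matrixP: BA => /(_ i i);
     rewrite !mxE eqxx => ->; rewrite mul1r addr0.
under eq_bigr do rewrite mulrA.
rewrite -mulr_suml; move/matrixP: BA => /(_ i j).
by rewrite !mxE eq_sym (negPf ji) => ->; rewrite mul0r.
Qed.

(** Taking coordinate [i] writes [eta i] as a combination of the [theta j], with the matrix of [psi]
    as coefficients, plus the coboundary of coordinate [i] of [g]. *)
Lemma lspan_combine theta eta (psi : {linear V -> V}) (g : {linear J -> V}) :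
  (forall x y, comb eta x y = psi (comb theta x y) + g (x \jo y)) ->
  <[eta]> `<=` <[theta]>.
Proof.
move=> etaE; apply: sub_lspan => i.
exists (fun j => coord e i (psi (tnth e j))); rewrite H2_class_lincomb.
apply/H2_classP; exists (coord e i \o g : {linear J -> F^o}) => x y.
rewrite -[LHS]/(eta i x y - (\sum_j _ : Z2 J F^o) x y) Z2_sum /=.
rewrite -[eta i x y]coord_combine etaE linearD linear_sum linear_sum /=.
rewrite addrAC -[RHS]add0r; congr (_ + _); apply/eqP; rewrite subr_eq0; apply/eqP.
by apply: eq_bigr => j _; rewrite !linearZ; apply: mulrC.
Qed.

Lemma isomorphic_combineP theta eta : T J s <[theta]> -> T J s <[eta]> ->
  isomorphic (extension (comb theta)) (extension (comb eta)) <->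
  exists phi : Aut J, <[theta]> = actG phi <[eta]>.
Proof.
move=> /T_lspanP[tfree]; rewrite -radical_combine => radt.
move=> /T_lspanP[efree]; rewrite -radical_combine => rade.
split=> [/(isomorphic_extension_inv radt rade)[phi [psi [psi' [g [psiK _ etaE]]]]]|].
  exists phi; rewrite actG_lspan; apply/seteqP; split.
    (* Applying [psi'] to [etaE] and solving for [theta] gives the corner [- (psi' \o g)]. *)
    apply: (@lspan_combine (fun i => act phi (eta i)) theta psi'
      (- (psi' \o g) : {linear J -> V})) => x y.
    rewrite -[comb (fun i => act phi (eta i)) x y]/(comb eta (phi x) (phi y)) etaE.
    by rewrite linearD psiK /= addrK.
  exact: (@lspan_combine theta (fun i => act phi (eta i)) psi g etaE).
move=> [phi]; rewrite actG_lspan => te.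
have [A tE] : exists A : 'M[F]_s, forall i,
    H2_class (act phi (eta i)) = \sum_j A i j *: H2_class (theta j).
  by apply: lspan_mx => i; rewrite te; apply: (mem_lspan (fun i => H2_class _)).
have [B eE] : exists B : 'M[F]_s, forall i,
    H2_class (theta i) = \sum_j B i j *: H2_class (act phi (eta j)).
  by apply: lspan_mx => i; rewrite -te; apply: (mem_lspan (fun i => H2_class _)).
have BA := lfree_mx1 tfree eE tE; have AB := mulmx1C BA.
(* Equality of classes lifts to cocycles up to coboundaries; the [f i] are the coordinates of the
   corner map, and [A] gives the block on [V]. *)
have /choice[f fE] i : exists f : {linear J -> F^o}, forall x y,
    eta i (phi x) (phi y) = \sum_j A i j * theta j x y + f (x \jo y).
  have := tE i; rewrite H2_class_lincomb => /H2_classP[f fE].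
  exists f => x y; rewrite -fE.
  rewrite -[X in _ + X]/(eta i (phi x) (phi y) - (\sum_j _ : Z2 J F^o) x y) Z2_sum.
  by rewrite addrC subrK.
have g_lin : linear (fun x => \sum_i (f i x : F) *: tnth e i).
  move=> a x y; rewrite scaler_sumr -big_split; apply: eq_bigr => i _.
  by rewrite /= scalerA -scalerDl linearP.
apply: (@isomorphic_extension F J V (comb theta) (comb eta) phi
  (linear_pack (mx_endo_linear A)) (linear_pack (mx_endo_linear B))
  (linear_pack g_lin)); try exact: mx_endoK.
move=> x y; rewrite /= -big_split; apply: eq_bigr => i _.
rewrite /= -scalerDl fE; congr ((_ + _) *: _).
by apply: eq_bigr => j _; rewrite coord_lincomb.
Qed.

End Classification.

(** * The correspondence between orbits and isomorphism classes *)

Theorem theorem4p8 (F : fieldType) (J : jordanType F) (s : nat)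
    (V : vectType F) (e : s.-tuple V) (he : basis_of fullv e) :
  exists Phi : set (set (H2 J F^o)) -> (jordanType F -> Prop),
    [/\ (forall O, T_orbits J s O -> iso_classes (E J s V) (Phi O)),
        (forall O O', T_orbits J s O -> T_orbits J s O' ->
           Phi O = Phi O' -> O = O'),
        (forall C, iso_classes (E J s V) C ->
           exists2 O, T_orbits J s O & Phi O = C) &
        (forall theta : 'I_s -> Z2 J F^o,
           let W := lspan (fun i => H2_class (theta i)) in
           T J s W ->
           Phi (Aut_orbit W) =
           iso_class (E J s V) (extension (combine (tnth e) theta)))].
Proof.
pose span (theta : 'I_s -> Z2 J F^o) := lspan (fun i => H2_class (theta i)).
pose cls (theta : 'I_s -> Z2 J F^o) :=
  iso_class (E J s V) (extension (combine (tnth e) theta)).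
(* Quantifying over all tuples representing [O] avoids choosing one; outside [T_orbits] the value is
   the empty class. *)
pose Phi (O : set (set (H2 J F^o))) (L : jordanType F) := exists theta,
  [/\ T J s (span theta), O = Aut_orbit (span theta) & cls theta L].
(* One direction makes [Phi] well defined, the other makes it injective. *)
have orbit_clsP theta eta : T J s (span theta) -> T J s (span eta) ->
    Aut_orbit (span theta) = Aut_orbit (span eta) <-> cls theta = cls eta.
  move=> Tt Te; split=> [ote|cte].
    apply/eq_iso_class; apply/(isomorphic_combineP he Tt Te).
    have : Aut_orbit (span eta) (span theta) by rewrite -ote; apply: Aut_orbit_refl.
    by move=> [phi _ phiE]; exists phi.
  (* The extension by [eta] lies in its own class, hence in that of [theta]. *)
  have [_] : cls theta (extension (combine (tnth e) eta)).
    by rewrite cte; split; [apply/E_combineP|exists; apply: iso_id].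
  move/(isomorphic_combineP he Tt Te) => [phi te].
  by rewrite /span te Aut_orbit_actG.
have PhiE theta : T J s (span theta) -> Phi (Aut_orbit (span theta)) = cls theta.
  move=> Tt; apply/funext => L; apply/propext; split=> [[eta [Te ote]]|tL].
    by move/(orbit_clsP _ _ Tt Te): ote => ->.
  by exists theta.
have orbitP O : T_orbits J s O ->
    exists2 theta, T J s (span theta) & O = Aut_orbit (span theta).
  move=> [W TW <-]; have [_ [theta [WE _]]] := TW.
  by exists theta; rewrite /span -WE.
exists Phi; split=> [O /orbitP[theta Tt ->]|O O' /orbitP[theta Tt ->]|C|//].
- rewrite PhiE //; exists (extension (combine (tnth e) theta)) => //.
  exact/E_combineP.
- move=> /orbitP[eta Te ->]; rewrite !PhiE //.
  by move/(orbit_clsP _ _ Tt Te).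
(* For surjectivity, the [V]-valued cocycle defining [K] is split into its coordinates. *)
move=> [K EK ->]; have [[theta KE] _] := EK.
move: EK; rewrite {K}KE; have [eta ->] := combine_surj he theta.
move=> /(E_combineP he) Te; exists (Aut_orbit (span eta)); last exact: PhiE.
by exists (span eta).
Qed.
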